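(* There exists a function $f:[0,1]^2\to\mathbb{R}$ satisfying the following conditions: (i) $f$ has a continuous partial derivative $f''_{yy}$ on $[0,1]^2$; (ii) for every $y\in[0,1]$ there exists a finite set $A(y)\subseteq[0,1]$ such that $f''_{xx}(x,y)$ exists and equals $0$ for all $x\in[0,1]\setminus A(y)$; (iii) the set $\bigcup_{y\in[0,1]}A(y)$ is countable, where $A(y)$ are the sets from (ii); (iv) there is a set $E\subseteq[0,1]^2$ of positive Lebesgue measure such that $f'_x$ is discontinuous with respect to $y$ at every point of $E$; in particular, $f''_{xy}$ does not exist at any point of $E$.
   Context: Derivatives are finite and pointwise (one-sided at endpoints). $f''_{xx}$ and $f''_{yy}$ are the second derivatives of $x\mapsto f(x,y)$ and $y\mapsto f(x,y)$ respectively, and $f''_{xy}=(f'_x)'_y$. ''$f'_x$ is discontinuous with respect to $y$ at $(x_0,y_0)$'' means that the function $y\mapsto f'_x(x_0,y)$ is discontinuous at $y_0$. *)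

(* Defs.v *)
From mathcomp Require Import all_boot all_order all_algebra.
From mathcomp Require Import all_classical all_reals all_analysis.
From mathcomp Require Import measurable_realfun.
Set Implicit Arguments.
Unset Strict Implicit.
Unset Printing Implicit Defensive.
Import Order.TTheory GRing.Theory Num.Theory.
Import numFieldNormedType.Exports.
Local Open Scope classical_set_scope.
Local Open Scope ring_scope.

(* Functions on [0,1] (resp. the unit square) are represented by functions on R
   (resp. R * R); the definitions below only look at their values on [0,1]
   (resp. the unit square). *)
Definition I01 (R : realType) : set R := `[0, 1].

Definition square01 (R : realType) : set (R * R) := @I01 R `*` @I01 R.

(* l is the finite derivative at x of g : [0,1] -> R, one-sided at 0 and 1
   (meant for x in [0,1]). *)
Definition has_deriv (R : realType) (g : R -> R) (x l : R) : Prop :=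
  (fun t => (g t - g x) / (t - x)) @ within (@I01 R) x^' --> l.

Definition has_dx (R : realType) (f : R * R -> R) (x y l : R) : Prop :=
  has_deriv (fun t => f (t, y)) x l.

Definition has_dy (R : realType) (f : R * R -> R) (x y l : R) : Prop :=
  has_deriv (fun t => f (x, t)) y l.

(* A first derivative may exist only at some points, so it is a partial
   function; for it to be differentiated, or tested for continuity, at a point,
   it must be defined on a neighbourhood of that point in [0,1], where g is its
   value. *)
Definition has_dxx (R : realType) (f : R * R -> R) (x y l : R) : Prop :=
  exists g : R -> R,
    (\forall t \near within (@I01 R) (nbhs x), has_dx f t y (g t)) /\
    has_deriv g x l.

Definition has_dyy (R : realType) (f : R * R -> R) (x y l : R) : Prop :=
  exists g : R -> R,
    (\forall t \near within (@I01 R) (nbhs y), has_dy f x t (g t)) /\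
    has_deriv g y l.

Definition has_dxy (R : realType) (f : R * R -> R) (x y l : R) : Prop :=
  exists g : R -> R,
    (\forall t \near within (@I01 R) (nbhs y), has_dx f x t (g t)) /\
    has_deriv g y l.

Definition dx_discontinuous_in_y (R : realType) (f : R * R -> R) (x y : R)
    : Prop :=
  exists g : R -> R,
    (\forall t \near within (@I01 R) (nbhs y), has_dx f x t (g t)) /\
    ~ (g @ within (@I01 R) (nbhs y) --> g y).

Definition continuous_dyy (R : realType) (f : R * R -> R) : Prop :=
  exists h : R * R -> R,
    (forall p, @square01 R p -> has_dyy f p.1 p.2 (h p)) /\
    {within @square01 R, continuous h}.

Definition lebesgue_measure2 (R : realType)
    : set (measurableTypeR R * measurableTypeR R) -> \bar R :=
  ((@lebesgue_measure R) \x (@lebesgue_measure R))%E.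

(* The library's measurable subsets of R * R are the Borel sets; the Lebesgue
   measurable ones form the completion. On them the outer measure induced by
   lebesgue_measure2 is the (complete) Lebesgue measure. *)
Definition positive_lebesgue_measure2 (R : realType) (E : set (R * R)) : Prop :=
  completed_algebra_gen (@lebesgue_measure2 R) E /\
  (0 < mu_ext (@lebesgue_measure2 R) E)%E.

(* Main.v *)
(** Let [K] be a compact subset of [0,1] whose only rationals are 0 and 1 and
which has positive measure.  On each gap [(a, b)] of [K] put
[f (x, y) = s x * ((y - a) * (b - y)) ^+ 3 * (4 / (b - a) ^+ 2) ^+ 3], where [s]
is a sawtooth of slopes +1 and -1, so flat that
[s * (4 / (b - a) ^+ 2) ^+ 3 <= 1]; put [f = 0] on [K].  Since
[(y - a) * (b - y)] is at most the distance from [y] to [K], [f] is C^2 in [y].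
Off the countably many corners of the sawteeth, [f'_x] vanishes on [K] but
equals +1 or -1 at the midpoint of every gap, and such midpoints accumulate at
every point of [K] outside a countable set. *)

Require Import Defs.
From mathcomp Require Import all_boot all_order all_algebra.
From mathcomp Require Import all_classical all_reals all_analysis.
From mathcomp Require Import measurable_realfun ring lra.
Import Order.TTheory GRing.Theory Num.Theory.
Import numFieldNormedType.Exports.
Local Open Scope classical_set_scope.
Local Open Scope ring_scope.

Set Implicit Arguments.
Unset Strict Implicit.
Unset Printing Implicit Defensive.

(** * One-sided derivatives on [0,1] *)

Lemma near_within01P (R : realType) (x : R) (P : R -> Prop) :
  (\forall t \near within (@I01 R) (nbhs x), P t) <->
  exists2 d : R, 0 < d & forall t, @I01 R t -> `|t - x| < d -> P t.
Proof.
rewrite near_withinE; split.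
  move=> /nbhs_ballP[d /= d0 H]; exists d => // t It tx.
  by apply: H => //; rewrite /ball /= distrC.
move=> [d d0 H]; apply/nbhs_ballP; exists d => //= t.
by rewrite /ball /= distrC => tx It; exact: H.
Qed.

Lemma has_derivP (R : realType) (g : R -> R) (x l : R) :
  has_deriv g x l <->
  forall e : R, 0 < e -> exists2 d : R, 0 < d &
    forall t, @I01 R t -> t != x -> `|t - x| < d ->
      `|(g t - g x) / (t - x) - l| < e.
Proof.
rewrite /has_deriv; split.
  move=> /cvgrPdist_lt H e e0; move: (H e e0).
  rewrite near_withinE => /nbhs_ballP[d /= d0 K]; exists d => // t It tx td.
  by rewrite distrC; apply: K => //; rewrite /ball /= distrC.
move=> H; apply/cvgrPdist_lt => e e0; have [d d0 K] := H e e0.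
rewrite near_withinE; apply/nbhs_ballP; exists d => //= t.
by rewrite /ball /= distrC => td tx It; rewrite distrC; exact: K.
Qed.

Lemma I01_accumulation (R : realType) (x d : R) : @I01 R x -> 0 < d ->
  exists t, [/\ @I01 R t, t != x & `|t - x| < d].
Proof.
rewrite /I01 /= in_itv /= => /andP[x0 x1] d0.
pose e := Num.min (d / 2) (1 / 2).
have e0 : 0 < e by rewrite /e lt_min; apply/andP; split; lra.
have ed : e < d by rewrite /e gt_min; apply/orP; left; lra.
have e2 : e <= 1 / 2 by rewrite /e ge_min lexx orbT.
have [xh|xh] := leP x (1 / 2).
  exists (x + e); split; first by rewrite /= in_itv /=; apply/andP; split; lra.
    by rewrite gt_eqF// ltrDl.
  by rewrite addrAC subrr add0r gtr0_norm.
exists (x - e); split; first by rewrite /= in_itv /=; apply/andP; split; lra.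
  by rewrite lt_eqF// gtrBl.
by rewrite addrAC subrr add0r normrN gtr0_norm.
Qed.

Lemma has_deriv_unique (R : realType) (g : R -> R) (x l m : R) : @I01 R x ->
  has_deriv g x l -> has_deriv g x m -> l = m.
Proof.
move=> Ix /has_derivP gl /has_derivP gm; apply/eqP/negPn/negP => lm.
have e0 : 0 < `|l - m| / 2 by rewrite divr_gt0// normr_gt0 subr_eq0.
have [d d0 H] := gl _ e0; have [d' d0' H'] := gm _ e0.
have dd : 0 < Num.min d d' by rewrite lt_min d0.
have [t [It tx]] := I01_accumulation Ix dd.
rewrite lt_min => /andP[td td'].
have := H t It tx td; have := H' t It tx td'.
move: ((g t - g x) / (t - x)) => q.
have := ler_distD q l m; rewrite (distrC l q); lra.
Qed.

Lemma has_deriv_continuous (R : realType) (g : R -> R) (x l : R) :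
  has_deriv g x l -> g @ within (@I01 R) (nbhs x) --> g x.
Proof.
move=> /has_derivP gl; apply/cvgrPdist_lt => e e0; apply/near_within01P.
have [d d0 H] := gl 1 ltr01.
have l1 : 0 < `|l| + 1 by rewrite ltr_wpDl.
exists (Num.min d (e / (`|l| + 1))); first by rewrite lt_min d0 divr_gt0.
move=> t It; rewrite lt_min => /andP[td te].
have [->|tx] := eqVneq t x; first by rewrite subrr normr0.
have tx0 : t - x != 0 by rewrite subr_eq0.
rewrite distrC; have -> : g t - g x = (g t - g x) / (t - x) * (t - x) by field.
rewrite normrM; move: te; rewrite ltr_pdivlMr// mulrC; apply: le_lt_trans.
apply: ler_wpM2r => //; have := H t It tx td.
move: ((g t - g x) / (t - x)) => q qd.
have := ler_normD (q - l) l; rewrite subrK; lra.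
Qed.

(** The difference quotient then differs from [l] by at most [M * |t - x|]. Every derivative below
    is established through this criterion. *)
Lemma has_deriv_quad (R : realType) (g : R -> R) (x l M : R) :
  (\forall t \near within (@I01 R) (nbhs x),
    `|g t - g x - l * (t - x)| <= M * (t - x) ^+ 2) ->
  has_deriv g x l.
Proof.
move=> /near_within01P[d d0 H]; apply/has_derivP => e e0.
have M1 : 0 < `|M| + 1 by rewrite ltr_wpDl.
exists (Num.min d (e / (`|M| + 1))); first by rewrite lt_min d0 divr_gt0.
move=> t It tx; rewrite lt_min => /andP[td te].
have tx0 : t - x != 0 by rewrite subr_eq0.
have -> : (g t - g x) / (t - x) - l = (g t - g x - l * (t - x)) / (t - x).
  by field.
rewrite normrM normfV ltr_pdivrMr ?normr_gt0//.
apply: (le_lt_trans (H t It td)).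
rewrite -normr_gt0 in tx0; rewrite -real_normK ?num_real// expr2 mulrA.
rewrite ltr_pM2r//; move: te; rewrite ltr_pdivlMr//; apply: le_lt_trans.
by rewrite mulrC ler_wpM2l// (le_trans (ler_norm M))// lerDl.
Qed.

(** By uniqueness of derivatives, the functions witnessing the two notions agree near [y] within
    [0,1], and differentiability of one at [y] would make the other continuous there. *)
Lemma not_has_dxy (R : realType) (f : R * R -> R) (x y : R) :
  @I01 R x -> @I01 R y -> dx_discontinuous_in_y f x y ->
  ~ exists l : R, has_dxy f x y l.
Proof.
move=> Ix Iy [g [gE gdisc]] [l [h [hE /has_deriv_continuous hy]]]; apply: gdisc.
have /near_within01P[d d0 gh] :
    \forall t \near within (@I01 R) (nbhs y), @I01 R t -> h t = g t.
  by near=> t => It; apply: (@has_deriv_unique R (fun s => f (s, t)) x) => //;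
    [near: t; exact: hE|near: t; exact: gE].
rewrite -(gh y)// ?subrr ?normr0//; apply: cvg_trans hy.
apply: near_eq_cvg; apply/near_within01P; exists d => // t It td.
exact: gh.
Unshelve. all: by end_near. Qed.

(** * Sawtooth functions *)

(** Each reflection at half the current height halves the range and keeps the slopes up to sign, so
    on [0,1] step [n] is a sawtooth of slopes +1 and -1 and height [2^-1 ^+ n]. *)
Fixpoint fold_tent (R : realType) (n : nat) (x : R) : R :=
  if n is m.+1 then `|fold_tent m x - 2^-1 ^+ m.+1| else x.

Fixpoint fold_corners (R : realType) (n : nat) : set R :=
  if n is m.+1
  then fold_corners m `|` [set x | fold_tent m x = 2^-1 ^+ m.+1]
  else set0.

Lemma fold_tent_bound (R : realType) n (x : R) : @I01 R x ->
  0 <= fold_tent n x <= 2^-1 ^+ n.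
Proof.
rewrite /I01 /= in_itv /= => /andP[x0 x1].
elim: n => [|n /= /andP[s0 s1]]; first by rewrite expr0 x0 x1.
by rewrite normr_ge0 ler_norml; move: s1; rewrite exprS; lra.
Qed.

Lemma fold_tent_lipschitz (R : realType) n (x y : R) :
  `|fold_tent n x - fold_tent n y| <= `|x - y|.
Proof.
elim: n => [|n IH] //=.
apply: le_trans (ler_dist_dist _ _) _.
by rewrite opprB addrA subrK.
Qed.

(** One reflection pulls a level back to at most two levels of the previous sawtooth, so the
    induction has to range over all [c]. *)
Lemma fold_tent_level_finite (R : realType) n (c : R) :
  finite_set [set x : R | fold_tent n x = c].
Proof.
elim: n c => [|n IH] c /=; first exact: finite_set1.
apply: (@sub_finite_set _ _ ([set x | fold_tent n x = 2^-1 ^+ n.+1 + c] `|`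
                        [set x | fold_tent n x = 2^-1 ^+ n.+1 - c])).
  move=> x /= <-; have [_|_] := ger0P (fold_tent n x - 2^-1 ^+ n.+1).
    by left; ring.
  by right; ring.
by rewrite finite_setU.
Qed.

Lemma fold_corners_finite (R : realType) n : finite_set (@fold_corners R n).
Proof.
elim: n => [|n IH] /=; first exact: finite_set0.
by rewrite finite_setU; split => //; exact: fold_tent_level_finite.
Qed.

Lemma fold_tent_affine (R : realType) n (x : R) : ~ fold_corners n x ->
  exists2 s : R, `|s| = 1 & exists2 d : R, 0 < d & forall t, `|t - x| < d ->
    fold_tent n t = fold_tent n x + s * (t - x).
Proof.
elim: n => [_|n IH /= /not_orP[/IH[s s1 [d d0 H]]]].
  by exists 1; [rewrite normr1|exists 1 => // t _ /=; ring].
move: (2^-1 ^+ n.+1) => c /eqP; rewrite -subr_eq0 -normr_gt0 => sc.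
have lip t : - `|t - x| <= fold_tent n t - fold_tent n x <= `|t - x|.
  by rewrite -ler_norml fold_tent_lipschitz.
move: (@fold_tent R n) H lip sc => g H lip sc.
(* Being 1-Lipschitz, [g] stays on the same side of [c] within distance [|g x - c|] of [x], so the
   absolute value only keeps or flips the slope there. *)
have d1 : 0 < Num.min d `|g x - c| by rewrite lt_min d0.
have [xc|xc] := ger0P (g x - c).
  exists s => //; exists (Num.min d `|g x - c|) => // t.
  rewrite lt_min (ger0_norm xc) => /andP[/H gt tc].
  have /andP[l1 _] := lip t; rewrite ger0_norm; last lra.
  by rewrite gt; ring.
exists (- s); first by rewrite normrN.
exists (Num.min d `|g x - c|) => // t.
rewrite lt_min (ltr0_norm xc) => /andP[/H gt tc].
have /andP[_ l2] := lip t; rewrite ltr0_norm; last lra.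
by rewrite gt; ring.
Qed.

(** * Gaps of a compact set *)

(** At [t] in [K] this forces [a t = t] or [b t = t], not both; one of them is enough for [parab] to
    vanish at [t]. *)
Definition gap_ends (R : realType) (K : set R) (a b : R -> R) : Prop :=
  forall t, @I01 R t -> [/\ K (a t), K (b t), a t <= t, t <= b t &
    forall k, K k -> k <= a t \/ b t <= k].

Lemma exists_gap_ends (R : realType) (K : set R) :
  compact K -> K 0 -> K 1 -> exists a b, gap_ends K a b.
Proof.
move=> cK K0 K1.
have idc (A : set R) : {within A, continuous (@idfun R)}.
  by apply: continuous_subspaceT => x; exact: cvg_id.
have H t : exists ab : R * R, @I01 R t ->
    [/\ K ab.1, K ab.2, ab.1 <= t, t <= ab.2 & forall k, K k -> k <= ab.1 \/ ab.2 <= k].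
  have [It|nIt] := pselect (@I01 R t); last by exists (0, 0).
  move: It; rewrite /I01 /= in_itv /= => /andP[t0 t1].
  have L0 : (K `&` [set x | x <= t]) !=set0 by exists 0.
  have R0 : (K `&` [set x | t <= x]) !=set0 by exists 1.
  have cL := compact_closedI cK (@closed_le R t).
  have cR := compact_closedI cK (@closed_ge R t).
  have [a /set_mem[Ka at_] aM] := compact_EVT_max L0 cL (idc _).
  have [b /set_mem[Kb tb] bM] := compact_EVT_min R0 cR (idc _).
  exists (a, b) => _; split => //= k Kk; have [kt|tk] := leP k t.
    by left; apply: aM; rewrite inE.
  by right; apply: bM; rewrite inE; split => //=; exact: ltW.
have [ab abP] := choice H.
by exists (fst \o ab), (snd \o ab) => t It; exact: abP.
Qed.

Lemma gap_ends_I01 (R : realType) (K : set R) a b t : K `<=` @I01 R ->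
  gap_ends K a b -> @I01 R t -> @I01 R (a t) /\ @I01 R (b t).
Proof. by move=> KI ab /ab[Ka Kb _ _ _]; split; exact: KI. Qed.

(** The ends lie in [K] and [K] misses the open gap, so comparing extremality at [t] and at [t']
    gives inequalities both ways. Hence [a] and [b] are locally constant off [K]. *)
Lemma gap_ends_const (R : realType) (K : set R) a b t t' : K `<=` @I01 R ->
  gap_ends K a b -> @I01 R t -> a t < t' -> t' < b t ->
  [/\ @I01 R t', a t' = a t & b t' = b t].
Proof.
move=> KI ab It at' t'b; have [Ia Ib] := gap_ends_I01 KI ab It.
have It' : @I01 R t'.
  move: Ia Ib; rewrite /I01 /= !in_itv /= => /andP[? _] /andP[_ ?].
  by apply/andP; split; lra.
have [Ka Kb at_ tb kt] := ab t It; have [Ka' Kb' at2 tb2 kt2] := ab t' It'.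
split => //; apply/le_anti/andP; split.
- by have [//|] := kt _ Ka'; lra.
- by have [//|] := kt2 _ Ka; lra.
- by have [|//] := kt2 _ Kb; lra.
- by have [|//] := kt _ Kb'; lra.
Qed.

(** * Parabolas over the gaps and their scaling *)

Definition parab (R : realType) (a b t : R) : R := (t - a) * (b - t).

(** The point [k] lies beyond one end of the gap: the factor of that end is at most [|t - k|], and
    the other is at most 1. *)
Lemma parab_le_dist (R : realType) (K : set R) a b t k : K `<=` @I01 R ->
  gap_ends K a b -> @I01 R t -> K k -> 0 <= parab (a t) (b t) t <= `|t - k|.
Proof.
move=> KI ab It Kk; have [Ka Kb at_ tb kt] := ab t It.
have [] := gap_ends_I01 KI ab It; rewrite /I01 /= !in_itv /=.
move=> /andP[a0 a1] /andP[b0 b1]; rewrite /parab.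
apply/andP; split; first by apply: mulr_ge0; lra.
have [ka|bk] := kt k Kk.
  rewrite ger0_norm; last by lra.
  apply: (@le_trans _ _ (t - a t)); last by lra.
  by apply: ler_piMr; lra.
rewrite distrC ger0_norm; last by lra.
apply: (@le_trans _ _ (b t - t)); last by lra.
by apply: ler_piMl; lra.
Qed.

Lemma parab_K (R : realType) (K : set R) a b t : K `<=` @I01 R ->
  gap_ends K a b -> K t -> parab (a t) (b t) t = 0.
Proof.
move=> KI ab Kt; have := parab_le_dist KI ab (KI _ Kt) Kt.
by rewrite subrr normr0 => /le_anti.
Qed.

Lemma not_K_gap (R : realType) (K : set R) a b t : gap_ends K a b ->
  @I01 R t -> ~ K t -> a t < t /\ t < b t.
Proof.
move=> ab It nKt; have [Ka Kb at_ tb _] := ab t It.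
split; rewrite lt_neqAle ?at_ ?tb andbT; apply/eqP => E; apply: nKt.
  by rewrite -E.
by rewrite E.
Qed.

(* [parab a b] peaks at [(b - a)^2 / 4]: this normalises its cube to height 1. *)
Definition peak_scale (R : realType) (a b : R) : R := (4 / (b - a) ^+ 2) ^+ 3.

(** The scale depends on the width [w] alone, while the sawtooth heights tend to 0 with the
    depth. *)
Lemma exists_fold_depth (R : realType) : exists N : R -> nat,
  forall w, 0 < w -> 2^-1 ^+ N w * (4 / w ^+ 2) ^+ 3 <= 1.
Proof.
suff H (w : R) : exists n, 0 < w -> 2^-1 ^+ n * (4 / w ^+ 2) ^+ 3 <= 1.
  by have [N NP] := choice H; exists N.
have [w0|nw0] := pselect (0 < w); last by exists 0%N => /nw0.
set c := (4 / w ^+ 2) ^+ 3.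
have c0 : 0 < c by rewrite exprn_gt0// divr_gt0// exprn_gt0.
have /cvgrPdist_le/(_ c^-1) : geometric (1 : R) 2^-1 x @[x --> \oo] --> 0.
  by apply: cvg_geometric; rewrite ger0_norm; lra.
rewrite invr_gt0 => /(_ c0)[n _ /(_ n (leqnn n))] H; exists n => _.
move: H; rewrite /= mul1r sub0r normrN ger0_norm; last first.
  by rewrite exprn_ge0// invr_ge0.
by rewrite -[leRHS]mul1r ler_pdivlMr.
Qed.

Definition amp (R : realType) (N : R -> nat) (a b : R -> R) (x y : R) : R :=
  fold_tent (N (b y - a y)) x * peak_scale (a y) (b y).

Lemma amp_le1 (R : realType) (K : set R) N a b x y :
  (forall w : R, 0 < w -> 2^-1 ^+ N w * (4 / w ^+ 2) ^+ 3 <= 1) ->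
  gap_ends K a b -> @I01 R x -> @I01 R y -> `|amp N a b x y| <= 1.
Proof.
move=> NP ab Ix /ab[_ _ ay yb _]; rewrite /amp /peak_scale.
have [s0 s1] := andP (fold_tent_bound (N (b y - a y)) Ix).
have c0 : 0 <= (4 / (b y - a y) ^+ 2) ^+ 3.
  by rewrite exprn_ge0// divr_ge0// sqr_ge0.
rewrite ger0_norm; last exact: mulr_ge0.
have [ab0|] := ltP 0 (b y - a y).
  by apply: le_trans (NP _ ab0); exact: ler_wpM2r.
(* In a degenerate gap the inverse of the width is 0 by convention, so the amplitude is 0. *)
move=> ba0; have -> : b y - a y = 0 by lra.
by rewrite expr0n invr0 mulr0 expr0n mulr0.
Qed.

(* At points of [K] the bound by [parab ^+ 2] makes the derivative vanish,
   elsewhere the gap is locally constant. *)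
Lemma gap_has_deriv (R : realType) (K : set R) N a b (P P' : R -> R -> R -> R)
    (M : R) (x y : R) :
  K `<=` @I01 R -> gap_ends K a b ->
  (forall w : R, 0 < w -> 2^-1 ^+ N w * (4 / w ^+ 2) ^+ 3 <= 1) ->
  0 <= M ->
  (forall c d t, @I01 R c -> @I01 R d -> @I01 R t ->
     `|P c d t| <= M * parab c d t ^+ 2) ->
  (forall c d t, parab c d t = 0 -> P' c d t = 0) ->
  (forall c d s t, @I01 R c -> @I01 R d -> @I01 R s -> @I01 R t ->
     `|P c d t - P c d s - P' c d s * (t - s)| <= M * (t - s) ^+ 2) ->
  @I01 R x -> @I01 R y ->
  has_deriv (fun t => amp N a b x t * P (a t) (b t) t) y
    (amp N a b x y * P' (a y) (b y) y).
Proof.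
move=> KI ab NP M0 P2 P'0 quad Ix Iy; apply: (@has_deriv_quad R _ _ _ M).
have [Ky|nKy] := pselect (K y).
  have py := parab_K KI ab Ky; have [Iay Iby] := gap_ends_I01 KI ab Iy.
  have Py : P (a y) (b y) y = 0.
    apply/eqP; rewrite -normr_le0.
    by apply: le_trans (P2 _ _ _ Iay Iby Iy) _; rewrite py expr0n mulr0.
  apply/near_within01P; exists 1 => // t It _.
  rewrite Py (P'0 _ _ _ py) !mulr0 mul0r !subr0 normrM.
  have [Iat Ibt] := gap_ends_I01 KI ab It.
  apply: (@le_trans _ _ `|P (a t) (b t) t|).
    by rewrite ler_piMl//; exact: (amp_le1 NP ab).
  apply: le_trans (P2 _ _ _ Iat Ibt It) _; apply: ler_wpM2l => //.
  have /andP[p0 pt] := parab_le_dist KI ab It Ky.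
  by rewrite -[leRHS]real_normK ?num_real// lerXn2r// nnegrE.
have [ay yb] := not_K_gap ab Iy nKy.
apply/near_within01P; exists (Num.min (y - a y) (b y - y)).
  by rewrite lt_min !subr_gt0 ay.
move=> t It; rewrite lt_min !ltr_norml => /andP[/andP[ta _] /andP[_ tb]].
have [] := @gap_ends_const R K a b y t KI ab Iy; [lra|lra|move=> _ atE btE].
have -> : amp N a b x t = amp N a b x y by rewrite /amp atE btE.
have [Iat Ibt] := gap_ends_I01 KI ab Iy.
rewrite atE btE -mulrA -!mulrBr normrM.
apply: le_trans (quad _ _ _ _ Iat Ibt Iy It).
by rewrite ler_piMl//; exact: (amp_le1 NP ab).
Qed.

(** * Taylor estimates for the cubed parabola *)

Lemma norm_mul_le (R : realType) (x y A B : R) :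
  `|x| <= A -> `|y| <= B -> `|x * y| <= A * B.
Proof. by move=> xA yB; rewrite normrM ler_pM. Qed.

Lemma parab_bounds (R : realType) (a b t : R) :
  @I01 R a -> @I01 R b -> @I01 R t ->
  `|parab a b t| <= 1 /\ `|a + b - t *+ 2| <= 2.
Proof.
rewrite /I01 /= !in_itv /= => /andP[a0 a1] /andP[b0 b1] /andP[t0 t1].
split; last by rewrite ler_norml mulr2n; lra.
by rewrite -[leRHS]mulr1; apply: norm_mul_le; rewrite ler_norml; lra.
Qed.

Definition cubic (R : realType) (a b t : R) : R := parab a b t ^+ 3.

Definition cubic' (R : realType) (a b t : R) : R :=
  3 * parab a b t ^+ 2 * (a + b - t *+ 2).

(** With [u = parab a b t] of derivative [p = a + b - 2t] and second derivative -2, this is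
    [6 u p^2 - 6 u^2]. *)
Definition cubic'' (R : realType) (a b t : R) : R :=
  6 * parab a b t * ((a + b - t *+ 2) ^+ 2 - parab a b t).

Lemma I01_dist (R : realType) (s t : R) : @I01 R s -> @I01 R t -> `|t - s| <= 1.
Proof.
by rewrite /I01 /= !in_itv /= => /andP[? ?] /andP[? ?]; rewrite ler_norml; lra.
Qed.

Lemma cubic_quad (R : realType) (a b s t : R) :
  @I01 R a -> @I01 R b -> @I01 R s -> @I01 R t ->
  `|cubic a b t - cubic a b s - cubic' a b s * (t - s)| <= 57 * (t - s) ^+ 2.
Proof.
move=> Ia Ib Is It; have [u1 p2] := parab_bounds Ia Ib Is.
have h1 := I01_dist Is It.
rewrite /cubic /cubic'; set h := t - s in h1 *.
set u := parab a b s in u1 *; set p := a + b - s *+ 2 in p2 *.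
have -> : parab a b t = u + h * (p - h) by rewrite /u /h /p /parab; ring.
(* The Taylor remainder, factored by [h ^+ 2]. As [|u| <= 1], [|p| <= 2] and [|h| <= 1], its three
   terms are at most 3, 27 and 27, whence 57. *)
have -> : (u + h * (p - h)) ^+ 3 - u ^+ 3 - 3 * u ^+ 2 * p * h =
  (- 3 * u * u + 3 * u * ((p - h) * (p - h)) +
    h * ((p - h) * (p - h) * (p - h))) * h ^+ 2 by ring.
have q3 : `|p - h| <= 3 by apply: le_trans (ler_normB _ _) _; lra.
have q9 := norm_mul_le q3 q3; have q27 := norm_mul_le q9 q3.
have u3 : `|3 * u| <= 3 by rewrite normrM ger0_norm//; lra.
have u3' : `|- 3 * u| <= 3 by rewrite mulNr normrN.
rewrite normrM (ger0_norm (sqr_ge0 h)); apply: ler_wpM2r; first exact: sqr_ge0.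
have e1 := norm_mul_le u3' u1; have e2 := norm_mul_le u3 q9.
have e3 := norm_mul_le h1 q27.
apply: le_trans (ler_normD _ _) _.
move: (ler_normD (- 3 * u * u) (3 * u * ((p - h) * (p - h)))); lra.
Qed.

Lemma cubic'_quad (R : realType) (a b s t : R) :
  @I01 R a -> @I01 R b -> @I01 R s -> @I01 R t ->
  `|cubic' a b t - cubic' a b s - cubic'' a b s * (t - s)|
    <= 156 * (t - s) ^+ 2.
Proof.
move=> Ia Ib Is It; have [u1 p2] := parab_bounds Ia Ib Is.
have h1 := I01_dist Is It.
rewrite /cubic' /cubic''; set h := t - s in h1 *.
set u := parab a b s in u1 *; set p := a + b - s *+ 2 in p2 *.
have -> : parab a b t = u + h * (p - h) by rewrite /u /h /p /parab; ring.
have -> : a + b - t *+ 2 = p - 2 * h by rewrite /h /p; ring.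
(* Here the two terms are at most [6 * 8] and [27 * 4], whence 156. *)
have -> : 3 * (u + h * (p - h)) ^+ 2 * (p - 2 * h) - 3 * u ^+ 2 * p -
    6 * u * (p ^+ 2 - u) * h =
  (6 * u * (- 3 * p + 2 * h) +
    3 * ((p - h) * (p - h)) * (p - 2 * h)) * h ^+ 2 by ring.
have q3 : `|p - h| <= 3 by apply: le_trans (ler_normB _ _) _; lra.
have q9 := norm_mul_le q3 q3.
have h2 : `|2 * h| <= 2 by rewrite normrM ger0_norm//; lra.
have p6 : `|- 3 * p| <= 6 by rewrite mulNr normrN normrM ger0_norm//; lra.
have u6 : `|6 * u| <= 6 by rewrite normrM ger0_norm//; lra.
have q4 : `|p - 2 * h| <= 4 by apply: le_trans (ler_normB _ _) _; lra.
have q8 : `|- 3 * p + 2 * h| <= 8 by apply: le_trans (ler_normD _ _) _; lra.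
have q27 : `|3 * ((p - h) * (p - h))| <= 27 by rewrite normrM ger0_norm//; lra.
rewrite normrM (ger0_norm (sqr_ge0 h)); apply: ler_wpM2r; first exact: sqr_ge0.
apply: le_trans (ler_normD _ _) _.
by move: (norm_mul_le u6 q8) (norm_mul_le q27 q4); lra.
Qed.

(** * The second derivative in y and its continuity *)

Definition gap_fun (R : realType) (N : R -> nat) (a b : R -> R) (p : R * R)
  : R :=
  amp N a b p.1 p.2 * cubic (a p.2) (b p.2) p.2.

Definition gap_fun_dyy (R : realType) (N : R -> nat) (a b : R -> R) (p : R * R)
  : R := amp N a b p.1 p.2 * cubic'' (a p.2) (b p.2) p.2.

Section gap_fun.
Context (R : realType) (K : set R) (N : R -> nat) (a b : R -> R).
Hypothesis KI : K `<=` @I01 R.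
Hypothesis ab : gap_ends K a b.
Hypothesis NP : forall w : R, 0 < w -> 2^-1 ^+ N w * (4 / w ^+ 2) ^+ 3 <= 1.

(** One differentiation lemma serves twice, for [cubic] and for [cubic']. The exponent 3 is what
    leaves a factor [parab ^+ 2] in [cubic']; the bounds by it hold with constants 1 and 6, well
    below the Taylor constants passed as [M]. *)
Lemma gap_fun_has_dyy (x y : R) : @I01 R x -> @I01 R y ->
  has_dyy (gap_fun N a b) x y (gap_fun_dyy N a b (x, y)).
Proof.
move=> Ix Iy; exists (fun t => amp N a b x t * cubic' (a t) (b t) t); split.
  apply/near_within01P; exists 1 => // t It _.
  apply: (@gap_has_deriv R K N a b (@cubic R) (@cubic' R) 57) => //.
  - move=> c d s Ic Id Is; rewrite /cubic exprS normrM (ger0_norm (sqr_ge0 _)).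
    apply: ler_wpM2r; first exact: sqr_ge0.
    by have [? _] := parab_bounds Ic Id Is; lra.
  - by move=> c d s E; rewrite /cubic' E expr0n /= mulr0 mul0r.
  - by move=> *; exact: cubic_quad.
apply: (@gap_has_deriv R K N a b (@cubic' R) (@cubic'' R) 156) => //.
- move=> c d s Ic Id Is; rewrite /cubic' mulrAC normrM (ger0_norm (sqr_ge0 _)).
  apply: ler_wpM2r; first exact: sqr_ge0.
  rewrite normrM ger0_norm//.
  by have [_ ?] := parab_bounds Ic Id Is; lra.
- by move=> c d s E; rewrite /cubic'' E mulr0 mul0r.
- by move=> *; exact: cubic'_quad.
Qed.

Lemma cubic''_le (c d t : R) : @I01 R c -> @I01 R d -> @I01 R t ->
  `|cubic'' c d t| <= 30 * `|parab c d t|.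
Proof.
move=> Ic Id It; have [u1 p2] := parab_bounds Ic Id It.
rewrite /cubic'' normrM normrM ger0_norm// mulrAC.
apply: ler_wpM2r => //.
have : `|(c + d - t *+ 2) ^+ 2| <= 4.
  by rewrite expr2; have := norm_mul_le p2 p2; lra.
by have := ler_normB ((c + d - t *+ 2) ^+ 2) (parab c d t); lra.
Qed.

Lemma fold_tent_continuous n : continuous (@fold_tent R n).
Proof.
move=> x; apply/cvgrPdist_lt => e e0; apply/nbhs_ballP; exists e => //= t xt.
exact: le_lt_trans (fold_tent_lipschitz _ _ _) xt.
Qed.

(** Near a point of [K], the value is at most 30 times the distance to that point, since the
    amplitude is at most 1. Off [K], the gap is locally constant and a continuous product
    remains. *)
Lemma gap_fun_dyy_cvg (x y : R) : @I01 R x -> @I01 R y ->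
  gap_fun_dyy N a b p @[p --> within (@square01 R) (nbhs (x, y))] -->
  gap_fun_dyy N a b (x, y).
Proof.
move=> Ix Iy.
have [Ky|nKy] := pselect (K y).
  have py := parab_K KI ab Ky.
  have -> : gap_fun_dyy N a b (x, y) = 0.
    by rewrite /gap_fun_dyy /= /cubic'' py mulr0 mul0r mulr0.
  apply/cvgrPdist_lt => e e0; rewrite near_withinE.
  apply/nbhs_ballP; exists (e / 30); first by rewrite /= divr_gt0.
  move=> [x' y'] [/= _ yy'] [/= Ix' Iy']; rewrite sub0r normrN.
  have [Iay Iby] := gap_ends_I01 KI ab Iy'.
  have /andP[p0 pt] := parab_le_dist KI ab Iy' Ky.
  rewrite /gap_fun_dyy /= normrM.
  apply: (@le_lt_trans _ _ `|cubic'' (a y') (b y') y'|).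
    by rewrite ler_piMl//; exact: (amp_le1 NP ab).
  apply: le_lt_trans (cubic''_le Iay Iby Iy') _; rewrite (ger0_norm p0).
  move: yy'; rewrite /ball /= distrC ltr_pdivlMr//; lra.
have [ay yb] := not_K_gap ab Iy nKy.
(* The same formula with the gap frozen at that of [y]. *)
pose h (p : R * R) : R :=
  fold_tent (N (b y - a y)) p.1 * peak_scale (a y) (b y) *
  cubic'' (a y) (b y) p.2.
have hc : h p @[p --> (x, y)] --> h (x, y).
  have c1 : p.1 @[p --> (x, y)] --> x by exact: cvg_fst.
  have c2 : p.2 @[p --> (x, y)] --> y by exact: cvg_snd.
  have cu : parab (a y) (b y) p.2 @[p --> (x, y)] --> parab (a y) (b y) y.
    by apply: cvgM; apply: cvgB => //; exact: cvg_cst.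
  have cp : (a y + b y - p.2 *+ 2) @[p --> (x, y)] --> a y + b y - y *+ 2.
    by apply: cvgB; [exact: cvg_cst|exact: cvgMn].
  apply: cvgM; first apply: cvgM; last 2 first.
  - exact: cvg_cst.
  - apply: cvgM; first by apply: cvgM cu; exact: cvg_cst.
    apply: cvgB cu; rewrite expr2; under eq_fun do rewrite expr2.
    exact: cvgM.
  by apply: cvg_comp c1 _; exact: fold_tent_continuous.
have -> : gap_fun_dyy N a b (x, y) = h (x, y) by [].
have d0 : 0 < Num.min (y - a y) (b y - y) by rewrite lt_min !subr_gt0 ay.
apply/cvgrPdist_lt => e e0; move/cvgrPdist_lt: hc => /(_ e e0) he.
have hd := near_ball (x, y) _ d0.
rewrite near_withinE; apply: (filterS2 _ _ he hd) => -[x' y'] /= {}he.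
move=> [/= _]; rewrite /ball /= lt_min => /andP[/ltr_normlW ? ty] _.
move: ty; rewrite ltr_norml => /andP[? _].
have [] := @gap_ends_const R K a b y y' KI ab Iy; [lra|lra|move=> _ atE btE].
by rewrite /gap_fun_dyy /amp /= atE btE.
Qed.

Lemma gap_fun_dyy_continuous :
  {within @square01 R, continuous (gap_fun_dyy N a b)}.
Proof.
by apply/subspace_continuousP => -[x y] [/= Ix Iy]; exact: gap_fun_dyy_cvg.
Qed.

End gap_fun.

(** * Derivatives in x and their discontinuity in y *)

Lemma affine_has_deriv (R : realType) (g : R -> R) (x c d : R) : 0 < d ->
  (forall t, `|t - x| < d -> g t = g x + c * (t - x)) -> has_deriv g x c.
Proof.
move=> d0 gE; apply: (@has_deriv_quad R _ _ _ 0); apply/near_within01P.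
by exists d => // t _ /gE ->; rewrite addrAC addrK subrr normr0 mul0r.
Qed.

Lemma peak_scale_midpoint (R : realType) (c d : R) : c < d ->
  peak_scale c d * cubic c d ((c + d) / 2) = 1.
Proof.
move=> cd; have dc : d - c != 0 by rewrite subr_eq0 gt_eqF.
by rewrite /peak_scale /cubic /parab; field.
Qed.

(** Up to sign, the derivative in x off the corners: 0 on [K], 1 at the midpoint of each
    nondegenerate gap. *)
Definition bump (R : realType) (a b : R -> R) (y : R) : R :=
  peak_scale (a y) (b y) * cubic (a y) (b y) y.

Lemma gap_fun_affine (R : realType) N (a b : R -> R) (x y : R) :
  ~ fold_corners (N (b y - a y)) x ->
  exists2 s : R, `|s| = 1 & exists2 d : R, 0 < d & forall t, `|t - x| < d ->
    gap_fun N a b (t, y) = gap_fun N a b (x, y) + s * bump a b y * (t - x).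
Proof.
move=> /fold_tent_affine[s s1 [d d0 H]]; exists s => //; exists d => // t /H E.
by rewrite /gap_fun /amp /= E /bump; ring.
Qed.

Lemma gap_fun_has_dxx (R : realType) N (a b : R -> R) (x y : R) :
  ~ fold_corners (N (b y - a y)) x -> has_dxx (gap_fun N a b) x y 0.
Proof.
move=> /(@gap_fun_affine R N a b x y)[s _ [d d0 H]].
exists (cst (s * bump a b y)); split.
  apply/near_within01P; exists d => // t _ tx.
  apply: (@affine_has_deriv R _ t (s * bump a b y) (d - `|t - x|)).
    by rewrite subr_gt0.
  move=> r rt; rewrite (H t tx) H; first by ring.
  by have := ler_distD t r x; lra.
by apply: (affine_has_deriv ltr01) => t _; rewrite /cst mul0r addr0.
Qed.

(** Rationals strictly between 0 and 1 lie in gaps, so a gap is found through a rational just right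
    of [y]. Excluding the countably many left ends [a (ratr q)] ensures that no such gap starts at
    [y]. *)
Lemma gap_midpoint_near (R : realType) (K : set R) a b (y d : R) :
  K `<=` @I01 R -> gap_ends K a b ->
  (forall q : rat, K (ratr q) -> ratr q = 0 :> R \/ ratr q = 1 :> R) ->
  K y -> y < 1 -> ~ (a @` range (@ratr R)) y -> 0 < d ->
  exists m, [/\ @I01 R m, `|m - y| < d & bump a b m = 1].
Proof.
move=> KI ab Kq Ky y1 yNa d0.
have Iy := KI _ Ky.
have y0 : 0 <= y by move: Iy; rewrite /I01 /= in_itv => /andP[].
have ratNK (q : rat) : y < ratr q -> ratr q < 1 :> R ->
    @I01 R (ratr q) /\ ~ K (ratr q).
  move=> yq q1; split.
    by rewrite /I01 /= in_itv /=; apply/andP; split; lra.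
  by move=> /Kq[] E; lra.
have /rat_in_itvoo[q] : y < Num.min 1 (y + d) by rewrite lt_min y1 ltrDl.
rewrite in_itv /= lt_min => /andP[yq /andP[q1 qd]].
have [Iq nKq] := ratNK q yq q1; have [aq qb] := not_K_gap ab Iq nKq.
have [Kaq _ _ _ /(_ y Ky) gq] := ab _ Iq.
have ya : y < a (ratr q).
  rewrite lt_neqAle; apply/andP; split; last by case: gq => //; lra.
  by apply/eqP => E; apply: yNa; exists (ratr q) => //; exists q.
(* The gap of [q] may extend beyond [y + d]. That of a second rational between [y] and [a (ratr q)]
   is confined to this interval, and so is its midpoint. *)
have /rat_in_itvoo[r] := ya; rewrite in_itv /= => /andP[yr ra].
have r1 : ratr r < 1 :> R by lra.
have [Ir nKr] := ratNK r yr r1; have [ar rb] := not_K_gap ab Ir nKr.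
have [_ _ _ _ gr] := ab _ Ir.
have yar : y <= a (ratr r) by case: (gr _ Ky) => //; lra.
have bra : b (ratr r) <= a (ratr q) by case: (gr _ Kaq) => //; lra.
pose m := (a (ratr r) + b (ratr r)) / 2.
have am : a (ratr r) < m by rewrite /m; lra.
have mb : m < b (ratr r) by rewrite /m; lra.
have [Im aE bE] := gap_ends_const KI ab Ir am mb.
exists m; split => //; first by rewrite ger0_norm; lra.
by rewrite /bump aE bE peak_scale_midpoint//; lra.
Qed.

Lemma gap_fun_dx_discontinuous (R : realType) (K : set R) N a b (x y : R) :
  K `<=` @I01 R -> gap_ends K a b ->
  (forall q : rat, K (ratr q) -> ratr q = 0 :> R \/ ratr q = 1 :> R) ->
  K y -> y < 1 -> ~ (a @` range (@ratr R)) y ->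
  ~ (\bigcup_n @fold_corners R n) x ->
  dx_discontinuous_in_y (gap_fun N a b) x y.
Proof.
move=> KI ab Kq Ky y1 yNa xN.
(* The sign of the slope may vary with [t]; only its absolute value 1 matters. *)
have /choice[s sP] t : exists s : R, `|s| = 1 /\ exists2 d : R, 0 < d &
    forall t', `|t' - x| < d -> gap_fun N a b (t', t) =
      gap_fun N a b (x, t) + s * bump a b t * (t' - x).
  have [|s s1 sP] := @gap_fun_affine R N a b x t; last by exists s.
  by move=> xc; apply: xN; exists (N (b t - a t)).
exists (fun t => s t * bump a b t); split.
  apply/near_within01P; exists 1 => // t It _.
  by have [_ [d d0 H]] := sP t; exact: affine_has_deriv d0 H.
have -> : s y * bump a b y = 0.
  by rewrite /bump /cubic (parab_K KI ab Ky) expr0n !mulr0.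
(* Tolerance 1 suffices: the limit would be 0, but at the midpoints the derivative has absolute
   value exactly 1. *)
move=> /cvgrPdist_lt/(_ 1 ltr01)/near_within01P[d d0 H].
have [m [Im md m1]] := gap_midpoint_near KI ab Kq Ky y1 yNa d0.
have := H m Im md; rewrite m1 mulr1 sub0r normrN.
by have [-> _] := sP m; rewrite ltxx.
Qed.

(** * Sets of positive measure *)

Lemma countable_setD_lebesgue (R : realType) (A C : set R) :
  measurable A -> countable C ->
  measurable (A `\` C) /\ lebesgue_measure (A `\` C) = lebesgue_measure A.
Proof.
move=> mA cC.
have mC : measurable C.
  by apply: countable_measurable cC => t; exact: measurable_set1.
have mD := measurableD mA mC; split => //.
have -> := @measureDI _ _ _ (@lebesgue_measure R) A C mA mC.
rewrite [X in (_ + X)%E]countable_lebesgue_measure0 ?adde0//.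
by apply: sub_countable cC; apply: subset_card_le; exact: subIsetr.
Qed.

Lemma positive_lebesgue_measure2_rect (R : realType) (A B : set R) :
  measurable A -> measurable B ->
  (0 < lebesgue_measure A)%E -> (0 < lebesgue_measure B)%E ->
  positive_lebesgue_measure2 (A `*` B).
Proof.
move=> mA mB A0 B0.
have mAB : measurable (A `*` B) by exact: measurableX.
split.
  exists (A `*` B) => //; exists set0; last by rewrite setU0.
  exact: negligible_set0.
rewrite /lebesgue_measure2 measurable_mu_extE//.
by rewrite [ltRHS]product_measure1E// mule_gt0.
Qed.

Lemma countable_image (T U : Type) (f : T -> U) (A : set T) :
  countable A -> countable (f @` A).
Proof. exact: sub_countable (card_image_le f A). Qed.

(** The irrationals of [0,1] have measure 1; inner regularity gives a compact subset missing less
    than 1/2 of it, which cannot be null. *)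
Lemma compact_irrational (R : realType) : exists K : set R,
  [/\ compact K, K `<=` @I01 R `\` range ratr & (0 < lebesgue_measure K)%E].
Proof.
have cQ : countable (range (@ratr R)) by exact/countable_image/countableP.
have mI : measurable (@I01 R) by exact: measurable_itv.
have [mD] := countable_setD_lebesgue mI cQ.
rewrite [RHS]lebesgue_measure_itv /= lte01 oppr0 adde0 => D1.
have [||V [cV VD Ve]] := @lebesgue_regularity_inner R _ (1 / 2) mD.
- by rewrite [X in (X < _)%E]D1 ltry.
- by rewrite divr_gt0.
exists V; split => //; rewrite lt0e measure_ge0 andbT; apply/eqP => V0.
have mV := compact_measurable cV.
have E : (lebesgue_measure (@I01 R `\` range ratr) =
    lebesgue_measure ((@I01 R `\` range ratr) `\` V) +
    lebesgue_measure ((@I01 R `\` range ratr) `&` V))%E by exact: measureDI.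
have VE : (@I01 R `\` range ratr) `&` V = V by rewrite setIC; exact/setIidPl.
rewrite VE [X in (_ + X)%E]V0 adde0 D1 in E.
by move: Ve; rewrite [X in (X < _)%E](esym E) lte_fin; lra.
Qed.

(** * Choice of the compact set, the corner sets and E *)

Theorem theorem5p2 (R : realType) :
  exists f : R * R -> R,
    [/\ continuous_dyy f,
        exists A : R -> set R,
          (forall y : R, @I01 R y ->
             [/\ finite_set (A y),
                 A y `<=` @I01 R
               & forall x : R, (@I01 R `\` A y) x -> has_dxx f x y 0]) /\
          countable (\bigcup_(y in @I01 R) A y)
      & exists E : set (R * R),
          [/\ E `<=` @square01 R,
              positive_lebesgue_measure2 E,
              forall p, E p -> dx_discontinuous_in_y f p.1 p.2
            & forall p, E p -> ~ exists l : R, has_dxy f p.1 p.2 l]].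
Proof.
have [K0 [cK0 K0D K0pos]] := compact_irrational R.
(* The points 0 and 1 give every [t] in [0,1] a point of [K] on each side. *)
pose K := K0 `|` ([set 0] `|` [set 1]).
have KI : K `<=` @I01 R.
  move=> y [/K0D[]//|[->|->]]; rewrite /I01 /= in_itv /=.
    by apply/andP; split; lra.
  by apply/andP; split; lra.
have cK : compact K by do 2 (apply: compactU => //; try exact: compact_set1).
have Kq (q : rat) : K (ratr q) -> ratr q = 0 :> R \/ ratr q = 1 :> R.
  by move=> [/K0D[_ []]|//]; exists q.
have [||a [b ab]] := exists_gap_ends cK; [by right; left|by right; right|].
have [N NP] := exists_fold_depth R.
have ccor : countable (\bigcup_n @fold_corners R n).
  apply: bigcup_countable => // n _.
  exact/finite_set_countable/fold_corners_finite.
have cQ : countable (a @` range (@ratr R)).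
  exact/countable_image/countable_image/countableP.
have [mX X1] := countable_setD_lebesgue (@measurable_itv R `[0, 1]) ccor.
have [mY Y0] := countable_setD_lebesgue (compact_measurable cK0) cQ.
have disc (p : R * R) : ((@I01 R `\` \bigcup_n @fold_corners R n) `*`
    (K0 `\` a @` range (@ratr R))) p ->
    [/\ @I01 R p.1, @I01 R p.2 & dx_discontinuous_in_y (gap_fun N a b) p.1 p.2].
  move=> [[Ix xN] [Ky yNa]]; have [Iy yQ] := K0D _ Ky; split => //.
  apply: (gap_fun_dx_discontinuous (K := K)) => //; first by left.
  move: Iy; rewrite /I01 /= in_itv /= lt_neqAle => /andP[_ ->]; rewrite andbT.
  (* [K0] avoids the rational 1. *)
  by apply/eqP => y1; apply: yQ; exists 1 => //; rewrite y1 rmorph1.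
exists (gap_fun N a b); split.
- exists (gap_fun_dyy N a b); split.
  2: exact: gap_fun_dyy_continuous KI ab NP.
  by move=> [x y] [/= Ix Iy]; exact: gap_fun_has_dyy KI ab NP _ _ Ix Iy.
(* The corners depend on [y] only through the depth, so their union over all [y] lies in a countable
   union of finite sets. *)
- exists (fun y => fold_corners (N (b y - a y)) `&` @I01 R); split.
    move=> y Iy; split; first exact/finite_setIl/fold_corners_finite.
      exact: subIsetr.
    move=> x [Ix xN]; apply: gap_fun_has_dxx => xc; exact: xN.
  apply: sub_countable ccor; apply: subset_card_le => x [y _ [xc _]].
  by exists (N (b y - a y)).
(* Both factors lose only countable sets, so their measures remain 1 and that of [K0]. *)
- exists ((@I01 R `\` \bigcup_n @fold_corners R n) `*`
    (K0 `\` a @` range (@ratr R))); split.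
  + by move=> p /disc[].
  + apply: positive_lebesgue_measure2_rect => //; last by rewrite Y0.
    by rewrite X1 lebesgue_measure_itv /= lte01 oppr0 adde0.
  + by move=> p /disc[].
  + by move=> p /disc[Ix Iy /not_has_dxy]; exact.
Qed.
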